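(* Let $X\subset\mathbb{R}^n$ be a nonempty compact set, let $f:X\to\mathbb{R}$ be a continuous function, let $g_1,\dots,g_N$ be linearly independent real polynomials in $n$ variables, and let $V=\operatorname{span}\{g_1,\dots,g_N\}$. Let $Q=\operatorname{Arg\,min}_{q\in V}\|f-q\|_\infty$, where $\|f-q\|_\infty=\max_{x\in X}|f(x)-q(x)|$. Then (i) $\mathcal{N}(q)=\mathcal{N}(p)$ and $\mathcal{P}(q)=\mathcal{P}(p)$ for all $p,q\in\operatorname{ri}Q$; (ii) $\mathcal{N}(q)\subseteq\mathcal{N}(p)$ and $\mathcal{P}(q)\subseteq\mathcal{P}(p)$ for all $q\in\operatorname{ri}Q$ and all $p\in Q$.
   Context: For $q\in V$, the sets of points of minimal and maximal deviation are $$\mathcal{N}(q)=\{x\in X\mid q(x)-f(x)=\|f-q\|_\infty\},\qquad \mathcal{P}(q)=\{x\in X\mid f(x)-q(x)=\|f-q\|_\infty\}.$$ Elements of $V$ are polynomials (not their restrictions to $X$). $V$ is identified with $\mathbb{R}^N$ via the coefficients in the representation $q=\sum_i a_i g_i$, and the relative interior $\operatorname{ri}Q$ is that of the corresponding convex set of coefficient vectors (the set $Q$ is nonempty, closed and convex). *)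

(* Defs.v *)
From HB Require Import structures.
From mathcomp Require Import all_boot all_order all_algebra.
From mathcomp Require Import all_classical all_reals all_analysis.
(* The notations of mpoly are incompatible with those of MathComp-Analysis. *)
From mathcomp Require Import -(notations) mpoly.

Set Implicit Arguments.
Unset Strict Implicit.
Unset Printing Implicit Defensive.

Import Order.TTheory GRing.Theory Num.Theory.
Import numFieldNormedType.Exports.

Local Open Scope classical_set_scope.
Local Open Scope ring_scope.

Definition peval (R : realType) (n : nat) (q : mpoly n R) (x : 'rV[R]_n) : R :=
  meval (fun i => x ord0 i) q.

Definition lincomb (R : realType) (n N : nat) (g : 'I_N -> mpoly n R)
    (a : 'rV[R]_N) : mpoly n R :=
  \sum_(i < N) a ord0 i *: g i.

(* Independence and span are those of the polynomials themselves, not of their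
   restrictions to a subset of R^n. *)
Definition lin_indep (R : realType) (n N : nat) (g : 'I_N -> mpoly n R) : Prop :=
  forall a : 'rV[R]_N, lincomb g a = 0 -> a = 0.

Definition pspan (R : realType) (n N : nat) (g : 'I_N -> mpoly n R)
    : set (mpoly n R) :=
  range (lincomb g).

Section RelativeInterior.
Variables (R : realType) (N : nat).
Implicit Type C : set 'rV[R]_N.

Definition affine_set C : Prop :=
  forall x y (t : R), C x -> C y -> C ((1 - t) *: x + t *: y).

Definition affine_hull C : set 'rV[R]_N := smallest affine_set C.

Definition relint C : set 'rV[R]_N :=
  [set x | affine_hull C x /\ \forall y \near x, affine_hull C y -> C y].

End RelativeInterior.

Section BestApproximation.
Variables (R : realType) (n : nat) (X : set 'rV[R]_n) (f : 'rV[R]_n -> R).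

(* The supremum is a maximum when X is nonempty and compact and f is continuous
   on X. *)
Definition deviation (q : mpoly n R) : R :=
  sup [set `|f x - peval q x| | x in X].

Definition min_dev_points (q : mpoly n R) : set 'rV[R]_n :=
  [set x | X x /\ peval q x - f x = deviation q].

Definition max_dev_points (q : mpoly n R) : set 'rV[R]_n :=
  [set x | X x /\ f x - peval q x = deviation q].

Definition best_approx (V : set (mpoly n R)) : set (mpoly n R) :=
  [set q | V q /\ forall p, V p -> deviation q <= deviation p].

(* The relative interior of the set of best approximations in the span of g,
   transported from coefficient vectors to polynomials. *)
Definition ri_best_approx (N : nat) (g : 'I_N -> mpoly n R) : set (mpoly n R) :=
  lincomb g @` relint (lincomb g @^-1` best_approx (pspan g)).

End BestApproximation.

(* Main.v *)
Require Import Defs.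
From HB Require Import structures.
From mathcomp Require Import all_boot all_order all_algebra.
From mathcomp Require Import all_classical all_reals all_analysis.
From mathcomp Require Import -(notations) mpoly.
From mathcomp Require Import ring lra.

(** Move from a best approximation [q] whose coefficient vector is a relative
interior point a little further along the line through another best
approximation [p], away from [p]: [r = q + t (q - p)] with some small [t > 0]
is again a best approximation ([relint_extend]).  The three polynomials have
the same deviation [D].  At a point of minimal deviation of [q] the signed
error [q - f] equals [D], and it is the convex combination
[(r - f + t (p - f)) / (1 + t)] of two errors that are at most [D]
([norm_err_le_deviation]); so both equal [D], and the point is also one of
minimal deviation of [p].  Points of maximal deviation are treated the same
way with the opposite sign.  The equalities between two relative interior
points are the inclusions used in both directions.

Compactness of [X] and continuity enter only to bound the error on [X]: the
deviation is a real supremum, which is known to dominate the errors only when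
they are bounded. *)

Import Order.TTheory GRing.Theory Num.Theory.
Import numFieldNormedType.Exports.

Local Open Scope classical_set_scope.
Local Open Scope ring_scope.

Set Implicit Arguments.
Unset Strict Implicit.

Lemma peval_lincomb (R : realType) (n N : nat) (g : 'I_N -> mpoly n R)
    (a : 'rV[R]_N) (x : 'rV[R]_n) :
  peval (lincomb g a) x = \sum_(i < N) a ord0 i * peval (g i) x.
Proof.
rewrite /peval /lincomb raddf_sum /=.
by apply: eq_bigr => i _; rewrite mevalZ.
Qed.

Lemma peval_extend (R : realType) (n N : nat) (g : 'I_N -> mpoly n R)
    (a b : 'rV[R]_N) (t : R) (x : 'rV[R]_n) :
  peval (lincomb g (a + t *: (a - b))) x =
  peval (lincomb g a) x
  + t * (peval (lincomb g a) x - peval (lincomb g b) x).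
Proof.
rewrite !peval_lincomb -sumrB mulr_sumr -big_split /=.
by apply: eq_bigr => i _; rewrite !mxE; ring.
Qed.

Lemma continuous_peval (R : realType) (n : nat) (q : mpoly n R) :
  continuous (peval q).
Proof.
have -> : peval q = fun y : 'rV[R]_n =>
    \sum_(m <- msupp q) mcoeff m q * \prod_(i < n) y ord0 i ^+ m i.
  by apply/funext => y; rewrite /peval mevalE.
have mono_cont (m : multinom n) :
    continuous (fun y : 'rV[R]_n => \prod_(i < n) y ord0 i ^+ m i).
  apply: (@continuous_big R _ *%R) => [|i _ x]; first exact: mul_continuous.
  apply: (@continuous_comp _ _ _ (fun y : 'rV[R]_n => y ord0 i)
    (fun z : R => z ^+ m i)); first exact: coord_continuous.
  exact: exprn_continuous.
apply: (@continuous_big R _ +%R) => [|m _ x].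
  exact: add_continuous.
exact: (cvgM (cvg_cst _) (mono_cont m x)).
Qed.

(** The line through [a] and [b] lies in the affine hull, so near the relative
interior point [a] it lies in the set itself, on both sides of [a]; the side
away from [b] is the one of interest. *)
Lemma relint_extend (R : realType) (N : nat) (C : set 'rV[R]_N)
    (a b : 'rV[R]_N) :
  relint C a -> C b -> exists2 t : R, 0 < t & C (a + t *: (a - b)).
Proof.
move=> [hull_a near_a] Cb.
have line_cvg : (fun t : R => a + t *: (a - b)) @ 0^'+ --> a.
  suff : (fun t : R => a + t *: (a - b)) @ 0^'+ --> a + 0 *: (a - b).
    by rewrite scale0r addr0.
  apply: cvgD; first exact: cvg_cst.
  by apply: cvgZr_tmp; apply: cvg_at_right_filter; exact: cvg_id.
have hull_line t : affine_hull C (a + t *: (a - b)).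
  move=> A [affA subA].
  have -> : a + t *: (a - b) = (1 - - t) *: a + (- t) *: b.
    by rewrite opprK scalerDl scale1r scalerBr scaleNr addrA.
  by apply: (affA); [exact: hull_a | exact: subA].
have near_line_a := line_cvg _ near_a : \forall t \near 0^'+,
    affine_hull C (a + t *: (a - b)) -> C (a + t *: (a - b)).
have near_line : \forall t \near 0^'+, C (a + t *: (a - b)).
  by apply: filterS near_line_a => t; apply; exact: hull_line.
have [t [t_gt0 Ct]] : exists t : R, 0 < t /\ C (a + t *: (a - b)).
  apply: (@filter_ex _ (0^'+ : set_system R)).
  by apply: filterI near_line; exact: nbhs_right_gt.
by exists t.
Qed.

Lemma norm_err_le_deviation (R : realType) (n : nat) (X : set 'rV[R]_n)
    (f : 'rV[R]_n -> R) (q : mpoly n R) (x : 'rV[R]_n) :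
  compact X -> {within X, continuous f} -> X x ->
  `|f x - peval q x| <= deviation X f q.
Proof.
move=> X_compact f_cont Xx.
have err_cont : {within X, continuous (fun y => f y - peval q y)}.
  move=> y; apply: cvgB; first exact: f_cont.
  by apply: continuous_subspaceT; exact: continuous_peval.
have [M [_ bndM]] := compact_bounded (continuous_compact err_cont X_compact).
apply: ub_le_sup; last by exists x.
exists (M + 1) => _ [y Xy <-].
by apply: (bndM (M + 1)); [rewrite ltrDl | exists y].
Qed.

Lemma best_approx_deviation (R : realType) (n : nat) (X : set 'rV[R]_n)
    (f : 'rV[R]_n -> R) (V : set (mpoly n R)) (p q : mpoly n R) :
  best_approx X f V p -> best_approx X f V q ->
  deviation X f p = deviation X f q.
Proof.
by move=> [Vp minp] [Vq minq]; apply/le_anti; rewrite minp // minq.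
Qed.

Lemma relint_subset (R : realType) (N : nat) (C : set 'rV[R]_N) :
  relint C `<=` C.
Proof. by move=> a [hull_a near_a]; exact: nbhs_singleton near_a hull_a. Qed.

Lemma ri_best_approx_subset (R : realType) (n N : nat) (X : set 'rV[R]_n)
    (f : 'rV[R]_n -> R) (g : 'I_N -> mpoly n R) :
  ri_best_approx X f g `<=` best_approx X f (pspan g).
Proof. by move=> _ [a /relint_subset best_a <-]; exact: best_a. Qed.

Lemma dev_points_ri_subset (R : realType) (n N : nat) (X : set 'rV[R]_n)
    (f : 'rV[R]_n -> R) (g : 'I_N -> mpoly n R) (q p : mpoly n R) :
  compact X -> {within X, continuous f} ->
  ri_best_approx X f g q -> best_approx X f (pspan g) p ->
  min_dev_points X f q `<=` min_dev_points X f p /\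
  max_dev_points X f q `<=` max_dev_points X f p.
Proof.
move=> X_compact f_cont ri_q best_p.
have dev_q := best_approx_deviation (ri_best_approx_subset ri_q) best_p.
case: ri_q dev_q => a ri_a <- dev_q.
have [[b _ pE] _] := best_p.
have best_b : (lincomb g @^-1` best_approx X f (pspan g)) b.
  by rewrite /preimage /= pE.
have [t t_gt0 best_r] := relint_extend ri_a best_b.
have dev_r := best_approx_deviation best_r best_p.
have err q x := @norm_err_le_deviation R n X f q x X_compact f_cont.
(* If [e] is the error of [p] at [x], with the sign for which that of [q] is
   the common deviation [D], then [|D + t (D - e)| <= D] gives [D <= e], and
   [|e| <= D]. *)
split=> x [Xx dev_x]; split=> //;
  have := err p x Xx; have := err (lincomb g (a + t *: (a - b))) x Xx;
  rewrite dev_r peval_extend pE !ler_norml => /andP[r_lo r_hi] /andP[p_lo p_hi];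
  rewrite dev_q in dev_x; apply/le_anti/andP; split; nra.
Qed.

Unset Implicit Arguments.
Set Strict Implicit.

Theorem theorem7 (R : realType) (n N : nat) (X : set 'rV[R]_n)
    (f : 'rV[R]_n -> R) (g : 'I_N -> mpoly n R)
    (X_neq0 : X !=set0) (X_compact : compact X)
    (f_cont : {within X, continuous f}) (g_indep : lin_indep g) :
  (forall p q : mpoly n R,
     ri_best_approx X f g p -> ri_best_approx X f g q ->
     min_dev_points X f q = min_dev_points X f p /\
     max_dev_points X f q = max_dev_points X f p) /\
  (forall q p : mpoly n R,
     ri_best_approx X f g q -> best_approx X f (pspan g) p ->
     min_dev_points X f q `<=` min_dev_points X f p /\
     max_dev_points X f q `<=` max_dev_points X f p).
Proof.
have incl q p := @dev_points_ri_subset R n N X f g q p X_compact f_cont.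
split=> // p q ri_p ri_q.
have [min_qp max_qp] := incl q p ri_q (ri_best_approx_subset ri_p).
have [min_pq max_pq] := incl p q ri_p (ri_best_approx_subset ri_q).
by split; apply/seteqP; split.
Qed.
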